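(* Let $f=\frac1n\sum_{i=1}^nf_i$ on $\mathbb{R}^d$ be bounded below, where each $f_i:\mathbb{R}^d\to\mathbb{R}$ is differentiable and satisfies $\|\nabla f_i(w)-\nabla f_i(w')\|\le L\|w-w'\|$ for all $w,w'\in\mathbb{R}^d$. Let $\eta>0$ be arbitrary and let $(w_{t,i})$ be the iterates of randomly-reshuffled AdaGrad (see context) with learning rate $\eta$, initial point $w_{1,1}\in\mathbb{R}^d$ and initial conditioner $\nu_{1,0}\in(0,\infty)^d$. Suppose there are constants $D_0\ge0$, $D_1>0$ such that for all epochs $t\ge1$ and all $i$, $$\frac1n\sum_{j=1}^n\|\nabla f_j(w_{t,i})\|^2\le D_0+D_1\|\nabla f(w_{t,i})\|^2.$$ Then there is a constant $C$, independent of $T$ and of the realization of the permutations, such that for every integer $T\ge1$, $$\min_{1\le t\le T}\|\nabla f(w_{t,1})\|^2\le C\,\frac{1+\ln(1+\sqrt{D_0T})}{T}+C\,\frac{\sqrt{D_0}\,\bigl(1+\ln(1+\sqrt{D_0T})\bigr)}{\sqrt{T}}.$$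
   Context: Randomly-reshuffled AdaGrad: given $f=\frac1n\sum_{i=1}^nf_i$, $\eta>0$, $w_{1,1}\in\mathbb{R}^d$ and $\nu_{1,0}\in(0,\infty)^d$, for each epoch $t=1,2,\dots$ a uniformly random permutation $(\tau_{t,1},\dots,\tau_{t,n})$ of $\{1,\dots,n\}$ is sampled, and for $i=1,\dots,n$ one sets $$g_{t,i}=\nabla f_{\tau_{t,i}}(w_{t,i}),\qquad\nu_{t,i}=\nu_{t,i-1}+g_{t,i}^{\odot2},\qquad w_{t,i+1}=w_{t,i}-\eta\,\frac{1}{\sqrt{\nu_{t,i}}}\odot g_{t,i},$$ where $\odot$ is the coordinate-wise product, $g^{\odot2}=g\odot g$, and square root and reciprocal are coordinate-wise. At the end of the epoch, $w_{t+1,1}=w_{t,n+1}$ and $\nu_{t+1,0}=\nu_{t,n}$. $\|\cdot\|$ is the Euclidean norm. *)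

(* Defs.v *)
From HB Require Import structures.
From mathcomp Require Export all_boot all_order all_algebra all_fingroup.
From mathcomp Require Export all_classical all_reals all_analysis.
Export Order.TTheory GRing.Theory Num.Theory numFieldNormedType.Exports.

Set Implicit Arguments.
Unset Strict Implicit.
Unset Printing Implicit Defensive.

Local Open Scope classical_set_scope.
Local Open Scope ring_scope.

(* The library norm on 'rV[R]_d is the sup norm, hence this definition. *)
Definition enorm (R : realType) (d : nat) (v : 'rV[R]_d) : R :=
  Num.sqrt (\sum_(j < d) v 0 j ^+ 2).

Definition gradient (R : realType) (d : nat) (h : 'rV[R]_d -> R)
    (w : 'rV[R]_d) : 'rV[R]_d :=
  \row_(j < d) 'D_(delta_mx 0 j) h w.

Definition average (R : realType) (d n : nat) (f : 'I_n -> 'rV[R]_d -> R)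
    (w : 'rV[R]_d) : R :=
  n%:R^-1 * \sum_(i < n) f i w.

Definition hadamard (R : realType) (d : nat) (u v : 'rV[R]_d) : 'rV[R]_d :=
  map2_mx *%R u v.

Definition rsqrt (R : realType) (d : nat) (v : 'rV[R]_d) : 'rV[R]_d :=
  map_mx (fun x => (Num.sqrt x)^-1) v.

(* The permutations drawn in epochs 1, 2, ... are independent and uniform:
   for every m, those of epochs 1, ..., m are uniform on (S_n)^m.  The index 0
   is not used. *)
Definition uniform_reshuffling (R : realType) (disp : measure_display)
    (Omega : measurableType disp) (P : probability Omega R) (n : nat)
    (tau : nat -> Omega -> {perm 'I_n}) : Prop :=
  (forall t (s : {perm 'I_n}),
     (1 <= t)%N -> measurable [set x | tau t x = s]) /\
  (forall m (s : nat -> {perm 'I_n}),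
     P [set x | forall t, (1 <= t <= m)%N -> tau t x = s t] =
     ((n`!%:R ^- m)%:E)).

(* One realization of a run.  Epochs t start at 1; w t i is meaningful for
   1 <= i <= n + 1 and nu t i for 0 <= i <= n.  Elements of 'I_n start at 0, so
   i : 'I_n is the inner step number i.+1 and tau t i its component. *)
Record rr_adagrad (R : realType) (d n : nat) (f : 'I_n -> 'rV[R]_d -> R)
    (eta : R) (w11 nu10 : 'rV[R]_d) (tau : nat -> {perm 'I_n})
    (w nu : nat -> nat -> 'rV[R]_d) : Prop := RRAdaGrad {
  rr_w_init : w 1%N 1%N = w11;
  rr_nu_init : nu 1%N 0%N = nu10;
  rr_nu_step : forall t (i : 'I_n), (1 <= t)%N ->
    let g := gradient (f (tau t i)) (w t i.+1) in
    nu t i.+1 = nu t i + hadamard g g;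
  rr_w_step : forall t (i : 'I_n), (1 <= t)%N ->
    let g := gradient (f (tau t i)) (w t i.+1) in
    w t i.+2 = w t i.+1 - eta *: hadamard (rsqrt (nu t i.+1)) g;
  rr_w_epoch : forall t, (1 <= t)%N -> w t.+1 1%N = w t n.+1;
  rr_nu_epoch : forall t, (1 <= t)%N -> nu t.+1 0%N = nu t n
}.

(* Main.v *)
Require Import Defs.
From mathcomp Require Import ring lra.

Set Implicit Arguments.
Unset Strict Implicit.
Unset Printing Implicit Defensive.

Local Open Scope classical_set_scope.
Local Open Scope ring_scope.

(* Since [g ^ 2 / nu <= ln nu - ln nu_prev] along each coordinate, the squared
   displacements [energy] sum to [O(ln V)], where [V] is the total mass of the
   conditioner.  Replacing [nu_{t,i}] by [nu_{t,0}] within an epoch costs, per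
   coordinate, at most a multiple of [q_t ^ 2 (r_t - r_{t+1})], where
   [r_t = 1 / sqrt nu_{t,0}] and [q_t] is the sum over the components of the
   absolute partial derivatives at the start of the epoch.  This telescopes as
   [q_t ^ 2 r_t - q_{t+1} ^ 2 r_{t+1}] up to energy terms: by smoothness
   [q_{t+1} - q_t] is at most a multiple of the displacement, and
   [q_t r_{t+1}] is controlled by [sum |g| / sqrt nu] because the gradients [g]
   of epoch [t] are already contained in [nu_{t+1,0}].  Hence
   [f + c * sum q ^ 2 r] decreases up to [O(ln V)], which gives
   [X <= (A + B ln V) sqrt V] for [X], the sum of the squared gradient norms.
   Conversely the noise bound gives [V <= c0 + c1 D0 T + c2 X + c3 ln V], so
   [V = O(1 + D0 T)], and the claim follows on dividing [X] by [T]. *)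

(** * Gradients and smoothness *)

(** Cauchy-Schwarz, from [x i * x j <= (x i ^+ 2 + x j ^+ 2) / 2] summed over all pairs. *)
Lemma sqr_sum_le (R : realType) (n : nat) (x : 'I_n -> R) :
  (\sum_(i < n) x i) ^+ 2 <= n%:R * \sum_(i < n) x i ^+ 2.
Proof.
rewrite expr2 big_distrlr /=.
have -> : n%:R * \sum_(i < n) x i ^+ 2 =
    \sum_(i < n) \sum_(j < n) (x i ^+ 2 + x j ^+ 2) / 2.
  under [RHS]eq_bigr => i _.
    rewrite -mulr_suml big_split /= sumr_const card_ord.
    over.
  rewrite -mulr_suml big_split /= sumr_const card_ord sumrMnl.
  rewrite -[_ *+ n]mulr_natl.
  by field.
apply: ler_sum => i _; apply: ler_sum => j _.
by have := sqr_ge0 (x i - x j); nra.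
Qed.

Lemma enorm_sqr (R : realType) (d : nat) (v : 'rV[R]_d) :
  enorm v ^+ 2 = \sum_(j < d) v 0 j ^+ 2.
Proof. by rewrite sqr_sqrtr// sumr_ge0// => j _; rewrite sqr_ge0. Qed.

Lemma enorm_ge0 (R : realType) (d : nat) (v : 'rV[R]_d) : 0 <= enorm v.
Proof. exact: sqrtr_ge0. Qed.

Lemma coord_le_enorm (R : realType) (d : nat) (v : 'rV[R]_d) j :
  `|v 0 j| <= enorm v.
Proof.
rewrite -sqrtr_sqr ler_wsqrtr// (bigD1 j)//= lerDl.
by rewrite sumr_ge0// => k _; rewrite sqr_ge0.
Qed.

Lemma gradient_average (R : realType) (d n : nat) (f : 'I_n -> 'rV[R]_d -> R)
    (w : 'rV[R]_d) j :
  (forall i, differentiable (f i) w) ->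
  gradient (average f) w 0 j = n%:R^-1 * \sum_(i < n) gradient (f i) w 0 j.
Proof.
move=> df; rewrite mxE.
have -> : average f = n%:R^-1 *: (\sum_(i < n) f i).
  by apply/funext => v; rewrite /average fctE fct_sumE.
rewrite deriveZ ?derive_sum; first last.
- by apply: derivable_sum => i; exact: diff_derivable.
- by move=> i; exact: diff_derivable.
by congr (_ * _); apply: eq_bigr => i _; rewrite mxE.
Qed.

Lemma differentiable_average (R : realType) (d n : nat)
    (f : 'I_n -> 'rV[R]_d -> R) (w : 'rV[R]_d) :
  (forall i, differentiable (f i) w) -> differentiable (average f) w.
Proof.
move=> df.
have -> : average f = n%:R^-1 *: (\sum_(i < n) f i).
  by apply/funext => v; rewrite /average fctE fct_sumE.
by apply: differentiableZ; exact: differentiable_sum.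
Qed.

Lemma derive_gradient (R : realType) (d : nat) (h : 'rV[R]_d -> R)
    (w v : 'rV[R]_d) :
  differentiable h w -> 'D_v h w = \sum_(j < d) gradient h w 0 j * v 0 j.
Proof.
move=> dh; rewrite deriveE// {1}(row_sum_delta v) linear_sum.
by apply: eq_bigr => j _; rewrite linearZ mxE deriveE// [RHS]mulrC.
Qed.

(** Mean value theorem on the segment from [x] to [y], where each partial derivative moves by at
    most [L * enorm (y - x)]. Arguing coordinatewise gives [d * L] in place of the sharp [L / 2]. *)
Lemma smooth_descent (R : realType) (d : nat) (h : 'rV[R]_d -> R) (L : R)
    (x y : 'rV[R]_d) :
  0 <= L ->
  (forall w, differentiable h w) ->
  (forall w w' j,
     `|gradient h w 0 j - gradient h w' 0 j| <= L * enorm (w - w')) ->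
  h y <= h x + \sum_(j < d) gradient h x 0 j * (y - x) 0 j
    + d%:R * L * enorm (y - x) ^+ 2.
Proof.
move=> L0 dh hL.
pose v := y - x; pose phi (s : R) := h (s *: v + x).
have dphi (s : R) : is_derive s (1 : R) phi ('D_v h (s *: v + x)).
  (* The difference quotients of [phi] at [s] are those of [h] in direction [v], so derivability
     transfers without a chain rule. *)
  have dq : (fun r : R => r^-1 *: ((phi \o shift s) (r *: (1 : R)) - phi s)) =
      (fun r => r^-1 *: ((h \o shift (s *: v + x)) (r *: v) - h (s *: v + x))).
    by apply/funext => r; rewrite /phi /= [_%:A]mulr1 scalerDl addrA.
  have dhs : derivable h (s *: v + x) v by exact: diff_derivable.
  by apply: DeriveDef; rewrite /derivable /derive dq.
have cphi : {within `[0, 1], continuous phi}.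
  apply: continuous_subspaceT => s.
  by apply/differentiable_continuous/derivable1_diffP; case: (dphi s).
have [c /itvP c01] := MVT ltr01 (fun s _ => dphi s) cphi.
rewrite subr0 mulr1 /phi scale1r scale0r add0r subrK => hyx.
rewrite -lerBlDl opprD addrA hyx derive_gradient// -sumrB -/v.
apply: (@le_trans _ _ (\sum_(j < d) L * enorm v ^+ 2)); last first.
  by rewrite sumr_const card_ord -mulrA mulr_natl.
apply: ler_sum => j _; rewrite -mulrBl (le_trans (ler_norm _))// normrM.
rewrite expr2 mulrA ler_pM ?normr_ge0 ?coord_le_enorm//.
apply: (le_trans (hL _ _ _)); rewrite addrK ler_wpM2l//.
rewrite ler_wsqrtr//; apply: ler_sum => k _; rewrite mxE exprMn.
by rewrite ler_piMl ?sqr_ge0// expr_le1 ?c01.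
Qed.

(** * Scalar inequalities *)

(** This is [ln (1 + x) <= x] at [x = a / b - 1]. *)
Lemma sub_div_le_ln (R : realType) (a b : R) :
  0 < a -> 0 < b -> (b - a) / b <= ln b - ln a.
Proof.
move=> a0 b0; have ab0 : 0 < a / b by rewrite divr_gt0.
have := @le_ln1Dx R (a / b - 1); rewrite subrKC ltrBrDl addrN => /(_ ab0).
rewrite ln_div// ?posrE// mulrBl divff ?gt_eqF//; lra.
Qed.

(* One coordinate of one epoch: [r], [r'] are [1 / sqrt nu] at its start and
   end, [p] is the absolute partial derivative of the average, [q], [q'] are the sums
   of those of the components at start and end, [e] bounds the drift of each
   component's derivative, [G], [W], [E] are [sum |g|], [sum |g| / sqrt nu] and
   [sum g ^ 2 / nu]. *)
Lemma scalar_epoch_bound (R : realType) (N r r' p q q' G W E e : R) :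
  1 <= N -> 0 <= r' -> r' <= r -> 0 <= e -> 0 <= p -> p <= q ->
  0 <= q' -> q' <= q + N * e -> 0 <= G -> G <= q + N * e -> q <= G + N * e ->
  G * r' <= W -> W ^+ 2 <= N * E ->
  - (N * p ^+ 2 * r) + p * (N * e) * r + p * G * (r - r') <=
  - (N / 2 * p ^+ 2 * r) + 3 / 2 * (q ^+ 2 * r - q' ^+ 2 * r')
    + 6 * N ^+ 2 * e ^+ 2 * r + 3 / 2 * (N ^+ 2 * e ^+ 2 + N * E).
Proof.
move=> N1 r'0 rr' e0 p0 pq q'0 q'q G0 Gq qG GW WE.
have r0 : 0 <= r by exact: le_trans rr'.
have q0 : 0 <= q by exact: le_trans pq.
set m := N * e in q'q Gq qG *.
have m0 : 0 <= m by rewrite mulr_ge0// (le_trans ler01).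
(* AM-GM: [p e <= (p ^ 2 + e ^ 2) / 2], then [N <= N ^ 2] *)
have drift : p * m * r <= (N / 2 * p ^+ 2 + 1 / 2 * m ^+ 2) * r.
  rewrite ler_wpM2r//.
  have : p * e <= (p ^+ 2 + e ^+ 2) / 2 by have := sqr_ge0 (p - e); nra.
  have : 0 <= (N - 1) * N * e ^+ 2.
    by rewrite !mulr_ge0 ?sqr_ge0//; lra.
  by rewrite /m; nra.
have conditioner : p * G * (r - r') <=
    (3 / 2 * q ^+ 2 + 1 / 2 * m ^+ 2) * (r - r').
  rewrite ler_wpM2r ?subr_ge0//.
  apply: (@le_trans _ _ (q * (q + m))); first by rewrite ler_pM.
  by have := sqr_ge0 (q - m); nra.
have step : q' ^+ 2 * r' <= (q + m) ^+ 2 * r'.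
  by rewrite ler_wpM2r// ler_pXn2r// ?nnegrE ?addr_ge0.
(* Expanding [(q + m) ^+ 2 * r'] leaves a term in [q * r']; replacing [q] by [G + m] brings it under
   [G * r' <= W]. *)
have cross : m * q * r' <= m * W + m ^+ 2 * r'.
  apply: (@le_trans _ _ (m * ((G + m) * r'))).
    by rewrite -mulrA ler_wpM2l// ler_wpM2r.
  by rewrite mulrDl mulrDr expr2 -[m * m * r']mulrA lerD2r ler_wpM2l.
have mW : 2 * (m * W) <= m ^+ 2 + N * E by have := sqr_ge0 (m - W); nra.
have mrr : m ^+ 2 * r' <= m ^+ 2 * r by rewrite ler_wpM2l ?sqr_ge0.
have mr0 : 0 <= m ^+ 2 * r' by rewrite mulr_ge0 ?sqr_ge0.
have -> : 6 * N ^+ 2 * e ^+ 2 = 6 * m ^+ 2 by rewrite /m; ring.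
have -> : N ^+ 2 * e ^+ 2 = m ^+ 2 by rewrite /m; ring.
by nra.
Qed.

(** For [z] the fourth root of [V], [ln V <= 4 * z], so the last summand is at most [M * z ^+ 3].
    Either [z <= 2 * M], which bounds [V] outright, or this summand is at most [V / 2] and is
    absorbed on the left. *)
Lemma log_self_bound (R : realType) (c0 c1 c2 c3 : R) :
  0 <= c0 -> 0 <= c1 -> 0 <= c2 -> 0 <= c3 ->
  exists2 K : R, 1 <= K & forall V Y, 1 <= V -> 0 <= Y ->
    V <= c0 + c1 * Y + (c2 + c3 * ln V) * Num.sqrt V ->
    V <= K * (1 + Y).
Proof.
move=> c00 c10 c20 c30.
pose M := c2 + 4 * c3.
exists (1 + (2 * M) ^+ 4 + 2 * c0 + 2 * c1) => [|V Y V1 Y0 hV].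
  by rewrite -!addrA lerDl !addr_ge0 ?mulr_ge0 ?exprn_ge0 ?addr_ge0 ?mulr_ge0.
have M0 : 0 <= M by rewrite addr_ge0 ?mulr_ge0.
pose z := Num.sqrt (Num.sqrt V).
have z2 : Num.sqrt V = z ^+ 2 by rewrite sqr_sqrtr ?sqrtr_ge0.
have z4 : V = z ^+ 4 by rewrite (exprM z 2 2) -z2 sqr_sqrtr// (le_trans ler01).
have z1 : 1 <= z by rewrite -[1]sqrtr1 ler_wsqrtr// -[1]sqrtr1 ler_wsqrtr.
have lnV : ln V <= 4 * z.
  rewrite z4 lnXn ?(lt_le_trans ltr01)// -[ln z *+ 4]mulr_natl ler_wpM2l//.
  by rewrite ltW// ln_sublinear// (lt_le_trans ltr01).
have MzV : (c2 + c3 * ln V) * Num.sqrt V <= M * z ^+ 3.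
  rewrite z2 (exprS z 2) [M * _]mulrA ler_wpM2r ?sqr_ge0// /M mulrDl lerD//.
    by rewrite ler_peMr.
  by rewrite [4 * c3]mulrC -mulrA ler_wpM2l.
have cY : 0 <= c1 * Y by rewrite mulr_ge0.
have M4 : 0 <= (2 * M) ^+ 4 by rewrite exprn_ge0 ?mulr_ge0.
have KY : (2 * M) ^+ 4 + 2 * c0 + 2 * (c1 * Y) <=
    (1 + (2 * M) ^+ 4 + 2 * c0 + 2 * c1) * (1 + Y) by nra.
apply: le_trans KY.
have [zM|Mz] := leP z (2 * M).
  have : z ^+ 4 <= (2 * M) ^+ 4.
    by rewrite ler_pXn2r// nnegrE ?mulr_ge0// (le_trans ler01).
  by rewrite -z4; lra.
have : 2 * M * z ^+ 3 <= V.
  by rewrite z4 (exprS z 3) ler_wpM2r ?exprn_ge0 ?(le_trans ler01)// ltW.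
by lra.
Qed.

(** Since [1 + Y <= (1 + Num.sqrt Y) ^+ 2], both [Num.sqrt V] and [ln V] are controlled by
    [1 + Num.sqrt Y] and its logarithm. *)
Lemma rate_of_log_bound (R : realType) (A B K : R) :
  0 <= A -> 0 <= B -> 1 <= K ->
  exists2 C : R, 0 <= C & forall V Y, 1 <= V -> 0 <= Y -> V <= K * (1 + Y) ->
    (A + B * ln V) * Num.sqrt V <=
      C * ((1 + ln (1 + Num.sqrt Y)) * (1 + Num.sqrt Y)).
Proof.
move=> A0 B0 K1.
have lnK0 : 0 <= ln K by rewrite ln_ge0.
have K0 : 0 < K by exact: lt_le_trans K1.
exists ((A + B * ln K + 2 * B) * Num.sqrt K) => [|V Y V1 Y0 VK].
  by rewrite mulr_ge0 ?sqrtr_ge0// !addr_ge0 ?mulr_ge0.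
set s := Num.sqrt Y; have s0 : 0 <= s by exact: sqrtr_ge0.
have s1 : 1 <= 1 + s by rewrite lerDl.
have sY : 1 + Y <= (1 + s) ^+ 2.
  by rewrite -[Y in 1 + Y]sqr_sqrtr// -/s; nra.
have VKs : V <= K * (1 + s) ^+ 2 by rewrite (le_trans VK)// ler_pM2l.
have s2p : 0 < (1 + s) ^+ 2 by rewrite exprn_gt0 ?(lt_le_trans ltr01).
have sqV : Num.sqrt V <= Num.sqrt K * (1 + s).
  rewrite (le_trans (ler_wsqrtr VKs))// sqrtrM ?(ltW K0)//.
  by rewrite sqrtr_sqr ger0_norm// addr_ge0.
have lnV : ln V <= ln K + 2 * ln (1 + s).
  apply: (@le_trans _ _ (ln (K * (1 + s) ^+ 2))).
    by rewrite ler_ln ?posrE ?mulr_gt0 ?(lt_le_trans ltr01).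
  by rewrite lnM ?posrE// lnXn ?(lt_le_trans ltr01)// mulr_natl.
have ln0 : 0 <= ln (1 + s) by rewrite ln_ge0.
have AB : A + B * ln V <= (A + B * ln K + 2 * B) * (1 + ln (1 + s)).
  apply: (@le_trans _ _ (A + B * (ln K + 2 * ln (1 + s)))).
    by rewrite lerD2l ler_wpM2l.
  have := mulr_ge0 A0 ln0; have := mulr_ge0 (mulr_ge0 B0 lnK0) ln0.
  by nra.
rewrite mulrACA ler_pM ?sqrtr_ge0 ?addr_ge0 ?mulr_ge0 ?ln_ge0//.
Qed.

(** [g] holds the derivatives met along the epoch, [h] those of the same components at its start.
    Freezing [g i] at [h i] and [r i.+1] at [r 0] yields the descent [n * p ^+ 2 * r 0];
    [scalar_epoch_bound] absorbs the two errors. *)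
Lemma coordinate_epoch_bound (R : realType) (n : nat) (g h : 'I_n -> R)
    (nu r : nat -> R) (p q' e : R) :
  (0 < n)%N -> 0 < nu 0%N -> (forall i, r i = (Num.sqrt (nu i))^-1) ->
  (forall i : 'I_n, nu i.+1 = nu i + g i ^+ 2) ->
  0 <= e -> (forall i, `|g i - h i| <= e) ->
  0 <= q' -> q' <= \sum_(i < n) `|h i| + n%:R * e ->
  p = n%:R^-1 * \sum_(i < n) h i ->
  - (p * \sum_(i < n) g i * r i.+1) <=
  - (n%:R / 2 * p ^+ 2 * r 0%N)
  + 3 / 2 * ((\sum_(i < n) `|h i|) ^+ 2 * r 0%N - q' ^+ 2 * r n)
  + 6 * n%:R ^+ 2 * e ^+ 2 * r 0%N
  + 3 / 2 * (n%:R ^+ 2 * e ^+ 2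
             + n%:R * \sum_(i < n) g i ^+ 2 / nu i.+1).
Proof.
move=> n0 nu0 rE nuS e0 gh q'0 q'q pE.
have N1 : 1 <= n%:R :> R by rewrite ler1n.
have N0 : 0 < n%:R :> R by rewrite ltr0n.
have nu_mono i j : (i <= j)%N -> (j <= n)%N -> nu i <= nu j.
  elim: j => [|j IH]; first by rewrite leqn0 => /eqP->.
  rewrite leq_eqVlt => /predU1P[->//|]; rewrite ltnS => leij ltj.
  rewrite (nuS (Ordinal ltj)).
  by rewrite (le_trans (IH leij (ltnW ltj)))// lerDl sqr_ge0.
have nu_gt0 i : (i <= n)%N -> 0 < nu i.
  by move=> /(nu_mono _ _ (leq0n i)); exact: lt_le_trans.
have r_ge0 i : 0 <= r i by rewrite rE invr_ge0 sqrtr_ge0.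
have r_le0 i : (i <= n)%N -> r i <= r 0%N.
  move=> lei; rewrite !rE lef_pV2 ?posrE ?sqrtr_gt0 ?nu_gt0//.
  by rewrite ler_wsqrtr// nu_mono.
have r_gen i : (i <= n)%N -> r n <= r i.
  move=> lei; rewrite !rE lef_pV2 ?posrE ?sqrtr_gt0 ?nu_gt0//.
  by rewrite ler_wsqrtr// nu_mono.
pose q : R := \sum_(i < n) `|h i|; pose G : R := \sum_(i < n) `|g i|.
have sum_e : \sum_(i < n) e = n%:R * e by rewrite sumr_const card_ord mulr_natl.
have Gq : G <= q + n%:R * e.
  rewrite -sum_e -big_split; apply: ler_sum => i _ /=.
  have := ler_normD (g i - h i) (h i); rewrite subrK.
  by move/le_trans; apply; rewrite [leRHS]addrC lerD2r.
have qG : q <= G + n%:R * e.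
  rewrite -sum_e -big_split; apply: ler_sum => i _ /=.
  have := ler_normD (h i - g i) (g i); rewrite subrK distrC.
  by move/le_trans; apply; rewrite [leRHS]addrC lerD2r.
have q0 : 0 <= q by apply: sumr_ge0.
have pq : `|p| <= q.
  rewrite pE normrM normfV [`|n%:R|]ger0_norm ?(ltW N0)// -[leRHS]mul1r.
  apply: ler_pM; rewrite ?invr_ge0 ?(ltW N0)// ?invf_le1//.
  exact: ler_norm_sum.
have WE : (\sum_(i < n) `|g i| * r i.+1) ^+ 2 <=
    n%:R * \sum_(i < n) g i ^+ 2 / nu i.+1.
  apply: (le_trans (sqr_sum_le _)); rewrite ler_wpM2l ?(ltW N0)//.
  apply: ler_sum => i _.
  by rewrite rE exprMn exprVn sqr_sqrtr ?real_normK ?num_real// ltW// nu_gt0.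
have GW : G * r n <= \sum_(i < n) `|g i| * r i.+1.
  rewrite mulr_suml; apply: ler_sum => i _.
  by rewrite ler_wpM2l// r_gen.
have := scalar_epoch_bound N1 (r_ge0 n) (r_le0 _ (leqnn n)) e0 (normr_ge0 p) pq
  q'0 q'q (sumr_ge0 _ (fun i _ => normr_ge0 (g i))) Gq qG GW WE.
rewrite real_normK ?num_real//; apply: le_trans.
have -> : - (p * \sum_(i < n) g i * r i.+1) =
    - (n%:R * p ^+ 2 * r 0%N) + p * (\sum_(i < n) (h i - g i)) * r 0%N
    + p * \sum_(i < n) g i * (r 0%N - r i.+1).
  have -> : n%:R * p ^+ 2 = p * \sum_(i < n) h i.
    by rewrite expr2 mulrA {1}pE mulrA divff ?mul1r ?gt_eqF// mulrC.
  have -> : \sum_(i < n) g i * (r 0%N - r i.+1) =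
      (\sum_(i < n) g i) * r 0%N - \sum_(i < n) g i * r i.+1.
    by rewrite mulr_suml -sumrB; apply: eq_bigr => i _; rewrite mulrBr.
  by rewrite sumrB; ring.
rewrite -!addrA lerD2l lerD//.
  rewrite ler_wpM2r// (le_trans (ler_norm _))// normrM ler_wpM2l//.
  rewrite -sum_e (le_trans (ler_norm_sum _ _ _))//; apply: ler_sum => i _.
  by rewrite distrC.
(* Since [r n <= r i.+1 <= r 0], each step is charged the decrease of [r] over the whole epoch. *)
rewrite (le_trans (ler_norm _))// normrM -mulrA ler_wpM2l//.
rewrite (le_trans (ler_norm_sum _ _ _))// mulr_suml; apply: ler_sum => i _.
rewrite normrM ler_wpM2l// ger0_norm ?subr_ge0 ?r_le0//.
by rewrite lerD2l lerN2 r_gen.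
Qed.

(** * Trajectories *)

Lemma coord_subE (R : realType) (d : nat) (u v : 'rV[R]_d) j :
  (u - v) 0 j = u 0 j - v 0 j.
Proof. by rewrite !mxE. Qed.

(** Matches the right-hand side of [coordinate_epoch_bound], to be summed over the coordinates. *)
Lemma sum_linear (R : realType) (d : nat) (c b k b' m N : R)
    (A B C r E : 'I_d -> R) :
  \sum_(j < d) (- (c * A j) + b * (B j - C j) + k * r j + b' * (m + N * E j)) =
  - (c * \sum_(j < d) A j) + b * (\sum_(j < d) B j - \sum_(j < d) C j)
  + k * (\sum_(j < d) r j) + b' * (d%:R * m + N * \sum_(j < d) E j).
Proof.
rewrite !big_split /= sumrN -!mulr_sumr !big_split /= sumrN -!mulr_sumr.
by rewrite sumr_const card_ord -[m *+ d]mulr_natl.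
Qed.

Section Trajectory.
Context (R : realType) (d n : nat) (f : 'I_n -> 'rV[R]_d -> R).
Context (L eta : R) (w11 nu10 : 'rV[R]_d).
Hypothesis n_gt0 : (0 < n)%N.
Hypothesis f_differentiable : forall i w, differentiable (f i) w.
Hypothesis L_ge0 : 0 <= L.
Hypothesis f_smooth : forall i w w',
  enorm (gradient (f i) w - gradient (f i) w') <= L * enorm (w - w').
Hypothesis eta_gt0 : 0 < eta.
Hypothesis nu10_gt0 : forall j, 0 < nu10 0 j.
Context (tau : nat -> {perm 'I_n}) (w nu : nat -> nat -> 'rV[R]_d).
Hypothesis run : rr_adagrad f eta w11 nu10 tau w nu.

Definition step_gradient t (i : 'I_n) := gradient (f (tau t i)) (w t i.+1).
Let F := average f.
Let g := step_gradient.

(** Times [eta ^+ 2], this is the sum of the squared lengths of the steps of epoch [t]. *)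
Definition energy t := \sum_(j < d) \sum_(i < n) g t i 0 j ^+ 2 / nu t i.+1 0 j.

Lemma gradient_coord_lipschitz i v v' j :
  `|gradient (f i) v 0 j - gradient (f i) v' 0 j| <= L * enorm (v - v').
Proof.
have := coord_le_enorm (gradient (f i) v - gradient (f i) v') j.
by rewrite coord_subE => /le_trans; apply.
Qed.

Lemma average_coord_lipschitz v v' j :
  `|gradient F v 0 j - gradient F v' 0 j| <= L * enorm (v - v').
Proof.
rewrite !gradient_average// -mulrBr -sumrB normrM normfV normr_nat.
rewrite ler_pdivrMl ?ltr0n// (le_trans (ler_norm_sum _ _ _))//.
rewrite mulr_natl -[n in leRHS]card_ord -sumr_const; apply: ler_sum => i _.
exact: gradient_coord_lipschitz.
Qed.

Lemma nu_stepE t (i : 'I_n) j : (0 < t)%N ->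
  nu t i.+1 0 j = nu t i 0 j + g t i 0 j ^+ 2.
Proof. by move=> t0; rewrite (rr_nu_step run i t0) !mxE expr2. Qed.

Lemma nu_ge_start t i j : (0 < t)%N -> (i <= n)%N -> nu t 0%N 0 j <= nu t i 0 j.
Proof.
move=> t0; elim: i => // i IH lti; rewrite (nu_stepE (Ordinal lti) j t0).
by rewrite (le_trans (IH (ltnW lti)))// lerDl sqr_ge0.
Qed.

Lemma nu_epoch_mono s t j : (0 < s)%N -> (s <= t)%N ->
  nu s 0%N 0 j <= nu t 0%N 0 j.
Proof.
move=> s0; elim: t => [|t IH]; first by rewrite leqn0 => /eqP->.
rewrite leq_eqVlt => /predU1P[->//|]; rewrite ltnS => st.
have t0 : (0 < t)%N by exact: leq_trans st.
by rewrite (rr_nu_epoch run t0) (le_trans (IH st))// nu_ge_start.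
Qed.

Lemma nu_ge_init t j : (0 < t)%N -> nu10 0 j <= nu t 0%N 0 j.
Proof. by move=> t0; rewrite -(rr_nu_init run) nu_epoch_mono. Qed.

Lemma nu_gt0 t i j : (0 < t)%N -> (i <= n)%N -> 0 < nu t i 0 j.
Proof.
move=> t0 lei; apply: lt_le_trans (nu_ge_start j t0 lei).
exact: lt_le_trans (nu_ge_init j t0).
Qed.

Lemma energy_ge0 t : (0 < t)%N -> 0 <= energy t.
Proof.
move=> t0; apply: sumr_ge0 => j _; apply: sumr_ge0 => i _.
by rewrite divr_ge0 ?sqr_ge0// ltW// nu_gt0.
Qed.

(** Filtering a sum over ['I_n] keeps [k] a legal argument of [tau t]; at [i = n] the filter is void
    and the whole epoch is covered. *)
Lemma displacementE t i j : (0 < t)%N -> (i <= n)%N ->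
  (w t i.+1 - w t 1%N) 0 j =
  - eta * \sum_(k < n | (k < i)%N) g t k 0 j / Num.sqrt (nu t k.+1 0 j).
Proof.
move=> t0; elim: i => [_|i IH lti].
  by rewrite subrr mxE big_pred0 ?mulr0.
have -> : w t i.+2 - w t 1%N = (w t i.+1 - w t 1%N)
    - eta *: hadamard (rsqrt (nu t i.+1)) (g t (Ordinal lti)).
  by rewrite (rr_w_step run (Ordinal lti) t0) addrAC.
rewrite coord_subE (IH (ltnW lti)) [in RHS](bigD1 (Ordinal lti)) ?ltnS//=.
rewrite mulrDr [RHS]addrC.
congr (_ + _); last by rewrite !mxE mulNr [_^-1 * _]mulrC.
congr (_ * _); apply: eq_bigl => k.
by rewrite ltnS andbC -[k != _]/(nat_of_ord k != i) -ltn_neqAle.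
Qed.

(** Cauchy-Schwarz after padding with zeros for the steps not yet taken, which makes the bound
    uniform in [i]. *)
Lemma displacement_le t i : (0 < t)%N -> (i <= n)%N ->
  enorm (w t i.+1 - w t 1%N) ^+ 2 <= n%:R * eta ^+ 2 * energy t.
Proof.
move=> t0 lei; rewrite enorm_sqr [n%:R * _]mulrC -mulrA !mulr_sumr.
apply: ler_sum => j _.
rewrite displacementE// exprMn sqrrN ler_wpM2l ?sqr_ge0// big_mkcond.
rewrite (le_trans (sqr_sum_le _))// ler_wpM2l//.
apply: ler_sum => k _; case: ifP => _.
  by rewrite exprMn exprVn sqr_sqrtr// ltW// nu_gt0.
by rewrite expr0n/= divr_ge0 ?sqr_ge0// ltW// nu_gt0.
Qed.

(** Each [g ^+ 2] is an increment of [nu], so [sub_div_le_ln] makes the sum telescope within the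
    epoch. *)
Lemma energy_le_ln t : (0 < t)%N ->
  energy t <= \sum_(j < d) (ln (nu t.+1 0%N 0 j) - ln (nu t 0%N 0 j)).
Proof.
move=> t0; apply: ler_sum => j _; rewrite (rr_nu_epoch run t0).
rewrite -(telescope_sumr (fun i => ln (nu t i 0 j))) // big_mkord.
apply: ler_sum => i _.
have -> : g t i 0 j ^+ 2 = nu t i.+1 0 j - nu t i 0 j.
  by rewrite nu_stepE// addrC addKr.
by rewrite sub_div_le_ln ?nu_gt0// ltnW.
Qed.

Definition abs_gradient_sum v j := \sum_(i < n) `|gradient (f i) v 0 j|.

(** Lyapunov function: the weight [3 / 2] is that of the telescoping term in
    [coordinate_epoch_bound], and [eta] comes from the step. *)
Definition potential t := F (w t 1%N)
  + 3 / 2 * eta * \sum_(j < d)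
      abs_gradient_sum (w t 1%N) j ^+ 2 / Num.sqrt (nu t 0%N 0 j).

(** The [eta] part collects the errors of the coordinate bounds with [e ^+ 2 = L ^+ 2 * (n * eta ^+
    2) * energy t]; the last summand is the quadratic term of [smooth_descent]. *)
Definition descent_const :=
  eta * (6 * n%:R ^+ 2 * (L ^+ 2 * (n%:R * eta ^+ 2)) *
           (\sum_(j < d) (Num.sqrt (nu10 0 j))^-1)
         + 3 / 2 * (d%:R * (n%:R ^+ 2 * (L ^+ 2 * (n%:R * eta ^+ 2))) + n%:R))
  + d%:R * L * (n%:R * eta ^+ 2).

Lemma descent_const_ge0 : 0 <= descent_const.
Proof.
rewrite !(addr_ge0, mulr_ge0) ?exprn_ge0 ?(ltW eta_gt0)//.
by apply: sumr_ge0 => j _; rewrite invr_ge0 sqrtr_ge0.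
Qed.

(** [smooth_descent] is applied to the displacement of a whole epoch, and its linear term is bounded
    one coordinate at a time. *)
Lemma potential_step t : (0 < t)%N ->
  potential t.+1
  + eta * n%:R / 2 * (\sum_(j < d) gradient F (w t 1%N) 0 j ^+ 2
                                    / Num.sqrt (nu t 0%N 0 j))
  <= potential t + descent_const * energy t.
Proof.
move=> t0; set x := w t 1%N; set D := n%:R * eta ^+ 2 * energy t.
pose y := w t n.+1.
have D0 : 0 <= D by rewrite mulr_ge0 ?energy_ge0// mulr_ge0 ?sqr_ge0.
pose e := L * Num.sqrt D.
have e2 : e ^+ 2 = L ^+ 2 * D by rewrite exprMn sqr_sqrtr.
have e0 : 0 <= e by rewrite mulr_ge0 ?sqrtr_ge0.
have dist i : (i <= n)%N -> L * enorm (w t i.+1 - x) <= e.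
  move=> lei; rewrite ler_wpM2l// -[leLHS]ger0_norm ?enorm_ge0// -sqrtr_sqr.
  by rewrite ler_wsqrtr// displacement_le.
have yE : w t.+1 1%N = y by rewrite (rr_w_epoch run t0).
(* An epoch visits every component once, so sums over the components may be taken in sampling
   order. *)
have sumE v j : abs_gradient_sum v j =
    \sum_(i < n) `|gradient (f (tau t i)) v 0 j|.
  by rewrite /abs_gradient_sum (reindex_inj (@perm_inj _ (tau t))).
have pE j : gradient F x 0 j =
    n%:R^-1 * \sum_(i < n) gradient (f (tau t i)) x 0 j.
  by rewrite gradient_average// (reindex_inj (@perm_inj _ (tau t))).
have coord j := @coordinate_epoch_bound R n (fun i => g t i 0 j)
  (fun i => gradient (f (tau t i)) x 0 j) (fun i => nu t i 0 j)
  (fun i => (Num.sqrt (nu t i 0 j))^-1) (gradient F x 0 j)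
  (abs_gradient_sum y j) e n_gt0 (nu_gt0 j t0 (leq0n n)) (fun=> erefl)
  (fun i => nu_stepE i j t0) e0.
have gh j i : `|g t i 0 j - gradient (f (tau t i)) x 0 j| <= e.
  by rewrite (le_trans (gradient_coord_lipschitz _ _ _ _))// dist// ltnW.
have qy j : abs_gradient_sum y j <=
    \sum_(i < n) `|gradient (f (tau t i)) x 0 j| + n%:R * e.
  rewrite sumE mulr_natl -[n in e *+ n]card_ord -sumr_const -big_split /=.
  apply: ler_sum => i _; rewrite addrC -lerBlDr (le_trans (lerB_dist _ _))//.
  by rewrite (le_trans (gradient_coord_lipschitz _ _ _ _))// dist.
have {}coord j := coord j (gh j)
  (sumr_ge0 _ (fun i _ => normr_ge0 _)) (qy j) (pE j).
pose p j : R := gradient F x 0 j.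
pose r j : R := (Num.sqrt (nu t 0%N 0 j))^-1.
pose r' j : R := (Num.sqrt (nu t n 0 j))^-1.
have sum_coord :
    \sum_(j < d) - (p j * \sum_(i < n) g t i 0 j / Num.sqrt (nu t i.+1 0 j)) <=
    - (n%:R / 2 * \sum_(j < d) p j ^+ 2 * r j)
    + 3 / 2 * (\sum_(j < d) abs_gradient_sum x j ^+ 2 * r j
               - \sum_(j < d) abs_gradient_sum y j ^+ 2 * r' j)
    + 6 * n%:R ^+ 2 * e ^+ 2 * (\sum_(j < d) r j)
    + 3 / 2 * (d%:R * (n%:R ^+ 2 * e ^+ 2) + n%:R * energy t).
  rewrite /energy -sum_linear; apply: ler_sum => j _.
  by rewrite [abs_gradient_sum x j]sumE mulrA; exact: coord.
have r_le : \sum_(j < d) r j <= \sum_(j < d) (Num.sqrt (nu10 0 j))^-1.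
  apply: ler_sum => j _; rewrite lef_pV2 ?posrE ?sqrtr_gt0 ?nu_gt0//.
  by rewrite ler_wsqrtr// nu_ge_init.
have := smooth_descent x y L_ge0
  (fun v => differentiable_average (f_differentiable^~ v))
  average_coord_lipschitz.
rewrite -/F => descent.
have moveE : \sum_(j < d) gradient F x 0 j * (y - x) 0 j = eta *
    \sum_(j < d) - (p j * \sum_(i < n) g t i 0 j / Num.sqrt (nu t i.+1 0 j)).
  rewrite mulr_sumr; apply: eq_bigr => j _; rewrite displacementE//.
  rewrite (eq_bigl xpredT) => [|i]; last by rewrite ltn_ord.
  by rewrite mulrN mulNr mulrN mulrCA.
rewrite moveE in descent.
have dxy : d%:R * L * enorm (y - x) ^+ 2 <= d%:R * L * D.
  by rewrite ler_wpM2l ?mulr_ge0// displacement_le.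
rewrite /potential yE (rr_nu_epoch run t0) -/x /descent_const.
have {}sum_coord := ler_wpM2l (ltW eta_gt0) sum_coord.
have {}r_le : 6 * n%:R ^+ 2 * e ^+ 2 * (\sum_(j < d) r j) <=
   6 * n%:R ^+ 2 * e ^+ 2 * \sum_(j < d) (Num.sqrt (nu10 0 j))^-1.
  by rewrite ler_wpM2l// mulr_ge0 ?sqr_ge0// mulr_ge0 ?sqr_ge0.
have {}r_le := ler_wpM2l (ltW eta_gt0) r_le.
rewrite e2 /D in sum_coord r_le dxy.
have -> : \sum_(j < d) gradient F x 0 j ^+ 2 / Num.sqrt (nu t 0%N 0 j) =
  \sum_(j < d) p j ^+ 2 * r j by [].
have -> : \sum_(j < d) abs_gradient_sum x j ^+ 2 / Num.sqrt (nu t 0%N 0 j) =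
  \sum_(j < d) abs_gradient_sum x j ^+ 2 * r j by [].
have -> : \sum_(j < d) abs_gradient_sum y j ^+ 2 / Num.sqrt (nu t n 0 j) =
  \sum_(j < d) abs_gradient_sum y j ^+ 2 * r' j by [].
lra.
Qed.

(** * Summation over the epochs *)

Definition gradient_sqr_sum T :=
  \sum_(1 <= t < T.+1) enorm (gradient F (w t 1%N)) ^+ 2.
(** The summand [1] ensures that the logarithm is nonnegative and the square root at least [1]. *)
Definition conditioner_mass T := 1 + \sum_(j < d) nu T.+1 0%N 0 j.

Lemma conditioner_mass_ge1 T : 1 <= conditioner_mass T.
Proof. by rewrite lerDl sumr_ge0// => j _; rewrite ltW// nu_gt0. Qed.

Lemma nu_le_conditioner_mass T t j : (0 < t)%N -> (t <= T.+1)%N ->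
  nu t 0%N 0 j <= conditioner_mass T.
Proof.
move=> t0 tT; apply: (le_trans (nu_epoch_mono j t0 tT)).
rewrite /conditioner_mass (bigD1 j)//= addrCA lerDl.
by rewrite addr_ge0// sumr_ge0// => k _; rewrite ltW// nu_gt0.
Qed.

Lemma energy_sum_le T : \sum_(1 <= t < T.+1) energy t <=
  d%:R * ln (conditioner_mass T) - \sum_(j < d) ln (nu10 0 j).
Proof.
have le_tele : \sum_(1 <= t < T.+1) energy t <=
    \sum_(j < d) (ln (nu T.+1 0%N 0 j) - ln (nu10 0 j)).
  elim: T => [|T IH].
    by rewrite big_geq// (rr_nu_init run) big1// => j _; rewrite subrr.
  rewrite (@big_nat_recr _ _ _ T.+1)//= (le_trans (lerD IH (energy_le_ln _)))//.
  rewrite -big_split; apply: ler_sum => j _ /=; rewrite addrC addrA subrK.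
  by [].
rewrite (le_trans le_tele)// sumrB lerD2r mulr_natl -[d in leRHS]card_ord.
rewrite -sumr_const; apply: ler_sum => j _.
rewrite ler_ln ?posrE ?nu_gt0//; first by rewrite nu_le_conditioner_mass.
exact: lt_le_trans ltr01 (conditioner_mass_ge1 _).
Qed.

Lemma potential_sum T :
  potential T.+1
  + eta * n%:R / 2 * (\sum_(1 <= t < T.+1) \sum_(j < d)
      gradient F (w t 1%N) 0 j ^+ 2 / Num.sqrt (nu t 0%N 0 j))
  <= potential 1 + descent_const * \sum_(1 <= t < T.+1) energy t.
Proof.
elim: T => [|T IH]; first by rewrite !big_geq// !mulr0 !addr0.
have step := potential_step (ltn0Sn T).
rewrite !(@big_nat_recr _ _ _ T.+1)//= !mulrDr; lra.
Qed.

(** Every conditioner entry up to epoch [T] is at most [conditioner_mass T], so the weighted sum in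
    [potential_sum] dominates [gradient_sqr_sum T] over the root of that mass. The absolute value
    keeps the constant nonnegative for the later scalar lemmas. *)
Lemma gradient_sum_le T (m : R) : (forall v, m <= F v) ->
  eta * n%:R / 2 * gradient_sqr_sum T <=
  (`|F w11 + 3 / 2 * eta * \sum_(j < d)
         abs_gradient_sum w11 j ^+ 2 / Num.sqrt (nu10 0 j)
     - m - descent_const * \sum_(j < d) ln (nu10 0 j)|
   + descent_const * d%:R * ln (conditioner_mass T))
  * Num.sqrt (conditioner_mass T).
Proof.
move=> mF; set gap := (X in `|X|).
have V0 : 0 < conditioner_mass T := lt_le_trans ltr01 (conditioner_mass_ge1 T).
have sV0 : 0 < Num.sqrt (conditioner_mass T) by rewrite sqrtr_gt0.
rewrite -ler_pdivrMr//.
have XV : gradient_sqr_sum T / Num.sqrt (conditioner_mass T) <=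
    \sum_(1 <= t < T.+1) \sum_(j < d)
      gradient F (w t 1%N) 0 j ^+ 2 / Num.sqrt (nu t 0%N 0 j).
  rewrite mulr_suml big_nat [leRHS]big_nat.
  apply: ler_sum => t /andP[t0 tT]; rewrite enorm_sqr mulr_suml.
  apply: ler_sum => j _; rewrite ler_wpM2l ?sqr_ge0//.
  rewrite lef_pV2 ?posrE ?sqrtr_gt0 ?nu_gt0// ler_wsqrtr//.
  rewrite nu_le_conditioner_mass//; exact: ltnW.
have e0 : 0 <= eta * n%:R / 2 by rewrite !mulr_ge0// ltW.
have {}XV := ler_wpM2l e0 XV.
have pot_ge : m <= potential T.+1.
  rewrite (le_trans (mF (w T.+1 1%N)))// lerDl !mulr_ge0 ?(ltW eta_gt0)//.
  by apply: sumr_ge0 => j _; rewrite mulr_ge0 ?sqr_ge0// invr_ge0 sqrtr_ge0.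
have pot := potential_sum T.
have en := ler_wpM2l descent_const_ge0 (energy_sum_le T).
have := ler_norm gap; rewrite /gap.
move: pot; rewrite {2}/potential (rr_w_init run) (rr_nu_init run).
lra.
Qed.

(** The mass grows by the squared sampled gradients. One factor [n] counts the steps of an epoch,
    the other turns the mean in the noise bound into a sum. *)
Lemma nu_growth (D0 D1 : R) T : 0 <= D0 -> 0 <= D1 ->
  (forall t i, (1 <= t)%N -> (1 <= i <= n)%N ->
     n%:R^-1 * \sum_(j < n) enorm (gradient (f j) (w t i)) ^+ 2
     <= D0 + D1 * enorm (gradient F (w t i)) ^+ 2) ->
  conditioner_mass T <= 1 + \sum_(j < d) nu10 0 j + n%:R ^+ 2 * (D0 * T%:R)
    + 2 * n%:R ^+ 2 * D1 * gradient_sqr_sum T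
    + 2 * n%:R ^+ 2 * D1 * (d%:R * L ^+ 2 * (n%:R * eta ^+ 2))
        * \sum_(1 <= t < T.+1) energy t.
Proof.
move=> D00 D10 noise.
have near_start t i : (0 < t)%N -> (i < n)%N ->
    enorm (gradient F (w t i.+1)) ^+ 2 <= 2 * enorm (gradient F (w t 1%N)) ^+ 2
      + 2 * (d%:R * L ^+ 2 * (n%:R * eta ^+ 2) * energy t).
  move=> t0 ltin; rewrite !enorm_sqr -mulrDr.
  have -> : d%:R * L ^+ 2 * (n%:R * eta ^+ 2) * energy t =
      \sum_(j < d) L ^+ 2 * (n%:R * eta ^+ 2 * energy t).
    by rewrite sumr_const card_ord -[RHS]mulr_natl; ring.
  rewrite -big_split mulr_sumr; apply: ler_sum => j _ /=.
  have := displacement_le t0 (ltnW ltin).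
  have := average_coord_lipschitz (w t i.+1) (w t 1%N) j.
  set a := gradient F _ 0 j; set b := gradient F _ 0 j => lip disp.
  have ab : (a - b) ^+ 2 <= L ^+ 2 * (n%:R * eta ^+ 2 * energy t).
    apply: le_trans (ler_wpM2l (sqr_ge0 L) disp).
    rewrite -exprMn -real_normK ?num_real// ler_pXn2r// nnegrE.
    by rewrite mulr_ge0// enorm_ge0.
  (* [2 * b ^+ 2 + 2 * (a - b) ^+ 2 - a ^+ 2] equals [(a - 2 * b) ^+ 2]. *)
  by have := sqr_ge0 (a - 2 * b); nra.
have grad_le t (i : 'I_n) : (0 < t)%N -> \sum_(j < d) g t i 0 j ^+ 2 <=
    n%:R * (D0 + D1 * (2 * enorm (gradient F (w t 1%N)) ^+ 2
      + 2 * (d%:R * L ^+ 2 * (n%:R * eta ^+ 2) * energy t))).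
  move=> t0; rewrite -enorm_sqr.
  apply: (@le_trans _ _ (\sum_(k < n) enorm (gradient (f k) (w t i.+1)) ^+ 2)).
    rewrite (bigD1 (tau t i))//= lerDl sumr_ge0// => k _; exact: sqr_ge0.
  rewrite -ler_pdivrMl ?ltr0n// (le_trans (noise t i.+1 t0 _)) ?ltn_ord//.
  by rewrite lerD2l ler_wpM2l// near_start.
have nu_sum t : (0 < t)%N -> \sum_(j < d) nu t.+1 0%N 0 j <=
    \sum_(j < d) nu t 0%N 0 j
    + n%:R ^+ 2 * (D0 + D1 * (2 * enorm (gradient F (w t 1%N)) ^+ 2
      + 2 * (d%:R * L ^+ 2 * (n%:R * eta ^+ 2) * energy t))).
  move=> t0; rewrite -lerBlDl -sumrB (rr_nu_epoch run t0).
  have -> : \sum_(j < d) (nu t n 0 j - nu t 0%N 0 j) =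
      \sum_(i < n) \sum_(j < d) g t i 0 j ^+ 2.
    rewrite exchange_big; apply: eq_bigr => j _ /=.
    rewrite -(telescope_sumr (fun i => nu t i 0 j))// big_mkord.
    by apply: eq_bigr => i _; rewrite nu_stepE// addrC addKr.
  rewrite (le_trans (ler_sum _ (fun i _ => grad_le t i t0)))//.
  rewrite sumr_const card_ord -[leLHS]mulr_natl.
  by rewrite [n%:R * (n%:R * _)]mulrA -expr2.
rewrite /conditioner_mass; elim: T => [|T IH].
  rewrite (rr_nu_init run) /gradient_sqr_sum !big_geq// !mulr0; lra.
have step := nu_sum T.+1 (ltn0Sn T); rewrite /gradient_sqr_sum in IH *.
rewrite !(@big_nat_recr _ _ _ T.+1)//= -[T.+1%:R]natr1 !mulrDr; lra.
Qed.

End Trajectory.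

(** * The rate *)

Lemma bigmin_le_mean (R : realType) (x : R) (u : nat -> R) (T : nat) :
  (0 < T)%N ->
  \big[Num.min/x]_(1 <= t < T.+1) u t <= (\sum_(1 <= t < T.+1) u t) / T%:R.
Proof.
move=> T0; rewrite ler_pdivlMr ?ltr0n// mulr_natr.
have -> : T = (T.+1 - 1)%N by rewrite subn1.
rewrite -sumr_const_nat subn1 big_nat [leRHS]big_nat; apply: ler_sum => t tT.
by apply: ge_bigmin_seq; rewrite // mem_index_iota.
Qed.

Theorem theorem7 (R : realType) (d n : nat) (f : 'I_n -> 'rV[R]_d -> R)
    (L eta D0 D1 : R) (w11 nu10 : 'rV[R]_d)
    (n_gt0 : (0 < n)%N)
    (f_bounded_below : exists m : R, forall w, m <= average f w)
    (f_differentiable : forall i w, differentiable (f i) w)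
    (f_smooth : forall i w w',
       enorm (gradient (f i) w - gradient (f i) w') <= L * enorm (w - w'))
    (eta_gt0 : 0 < eta)
    (nu10_gt0 : forall j, 0 < nu10 0 j)
    (D0_ge0 : 0 <= D0) (D1_gt0 : 0 < D1) :
  exists C : R,
    forall (disp : measure_display) (Omega : measurableType disp)
      (P : probability Omega R) (tau : nat -> Omega -> {perm 'I_n}),
      uniform_reshuffling P tau ->
    forall (x : Omega) (w nu : nat -> nat -> 'rV[R]_d),
      rr_adagrad f eta w11 nu10 (tau^~ x) w nu ->
      (forall t i, (1 <= t)%N -> (1 <= i <= n)%N ->
         n%:R^-1 * \sum_(j < n) enorm (gradient (f j) (w t i)) ^+ 2
         <= D0 + D1 * enorm (gradient (average f) (w t i)) ^+ 2) ->
    forall T : nat, (1 <= T)%N ->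
      \big[Num.min/enorm (gradient (average f) (w 1%N 1%N)) ^+ 2]_(1 <= t < T.+1)
        enorm (gradient (average f) (w t 1%N)) ^+ 2
      <= C * ((1 + ln (1 + Num.sqrt (D0 * T%:R))) / T%:R)
         + C * (Num.sqrt D0 * (1 + ln (1 + Num.sqrt (D0 * T%:R)))
                / Num.sqrt T%:R).
Proof.
have [m mF] := f_bounded_below.
(* [L] comes without a sign, so [|L|] serves as the Lipschitz constant. *)
have L'_ge0 : 0 <= `|L| := normr_ge0 L.
have f_smooth' i v v' :
    enorm (gradient (f i) v - gradient (f i) v') <= `|L| * enorm (v - v').
  by rewrite (le_trans (f_smooth i v v'))// ler_wpM2r ?enorm_ge0// ler_norm.
pose N : R := n%:R; have N0 : 0 < N by rewrite ltr0n.
pose h := eta * N / 2; have h0 : 0 < h by rewrite !mulr_gt0// invr_gt0.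
pose K : R := descent_const n `|L| eta nu10.
have K0 : 0 <= K := descent_const_ge0 n nu10 L'_ge0 eta_gt0.
pose S : R := \sum_(j < d) ln (nu10 0 j).
pose gap : R := `|average f w11 + 3 / 2 * eta
  * \sum_(j < d) abs_gradient_sum f w11 j ^+ 2 / Num.sqrt (nu10 0 j)
  - m - K * S|.
pose A := gap / h; pose B := K * d%:R / h.
have A0 : 0 <= A by rewrite divr_ge0 ?normr_ge0// ltW.
have B0 : 0 <= B by rewrite divr_ge0 ?mulr_ge0// ltW.
(* [k1] and [k2] are the coefficients of the gradient sum and of the energy in [nu_growth]; [c0]
   takes in [k2 * |S|] because [S] may have either sign. *)
pose k1 := 2 * N ^+ 2 * D1.
have k10 : 0 <= k1 by rewrite mulr_ge0 ?(ltW D1_gt0)// mulr_ge0 ?sqr_ge0.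
pose k2 := k1 * (d%:R * `|L| ^+ 2 * (N * eta ^+ 2)).
have k20 : 0 <= k2.
  by rewrite !mulr_ge0 ?exprn_ge0 ?(ltW eta_gt0) ?(ltW D1_gt0).
pose c0 : R := 1 + \sum_(j < d) nu10 0 j + k2 * `|S|.
have c00 : 0 <= c0.
  rewrite addr_ge0 ?(mulr_ge0 k20 (normr_ge0 S))// addr_ge0// sumr_ge0// => j _.
  exact: ltW.
have [Kv Kv1 V_bound] := @log_self_bound R c0 (N ^+ 2) (k1 * A)
  (k1 * B + k2 * d%:R) c00 (sqr_ge0 N) (mulr_ge0 k10 A0)
  (addr_ge0 (mulr_ge0 k10 B0) (mulr_ge0 k20 (ler0n _ d))).
(* [C] is fixed before the permutations and [T] are introduced, hence its uniformity. *)
have [C C0 rate] := rate_of_log_bound A0 B0 Kv1.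
exists C => disp Omega P tau _ x w nu run noise T T1.
pose X := gradient_sqr_sum f w T.
pose V := conditioner_mass nu T.
pose Y := D0 * T%:R; have Y0 : 0 <= Y by rewrite mulr_ge0.
have V1 : 1 <= V := conditioner_mass_ge1 nu10_gt0 run T.
have XV : X <= (A + B * ln V) * Num.sqrt V.
  have := gradient_sum_le n_gt0 f_differentiable L'_ge0 f_smooth' eta_gt0
    nu10_gt0 run T mF.
  rewrite -/N -/h -/K -/S -/gap -/X -/V -ler_pdivlMl// => /le_trans; apply.
  by rewrite mulrA /A /B mulrDr [h^-1 * gap]mulrC mulrA [h^-1 * _]mulrC.
have energyV := ler_wpM2l k20 (energy_sum_le nu10_gt0 run T).
have := nu_growth n_gt0 f_differentiable L'_ge0 f_smooth' nu10_gt0 run T D0_ge0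
  (ltW D1_gt0) noise.
rewrite -/N -/k1 -/k2 -/X -/V -/Y => growth.
have lnV0 : 0 <= ln V by rewrite ln_ge0.
have sqV1 : 1 <= Num.sqrt V by rewrite -[leLHS]sqrtr1 ler_wsqrtr.
have V_le : V <= Kv * (1 + Y).
  apply: V_bound => //.
  (* The energy contributes a bare [ln V]; the factor [Num.sqrt V >= 1] fits it to the form of
     [log_self_bound]. *)
  have k2lnV : k2 * d%:R * ln V <= k2 * d%:R * ln V * Num.sqrt V.
    by rewrite ler_peMr// (mulr_ge0 (mulr_ge0 k20 (ler0n _ d))).
  have kX := ler_wpM2l k10 XV.
  have kS : - (k2 * S) <= k2 * `|S|.
    by rewrite -mulrN ler_wpM2l// -normrN ler_norm.
  move: energyV; rewrite -/V -/S /c0; lra.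
have T0 : 0 < T%:R :> R by rewrite ltr0n.
apply: (le_trans (bigmin_le_mean _ _ T1)).
rewrite -/(gradient_sqr_sum f w T) -/X -mulrDr ler_pdivrMr//.
rewrite (le_trans XV)// (le_trans (rate V Y V1 Y0 V_le))//.
rewrite -[leRHS]mulrA ler_wpM2l// -/Y.
(* With [T = s ^+ 2], both sides become [C * l * (1 + Num.sqrt D0 * s)], so equality holds. *)
have -> : Num.sqrt Y = Num.sqrt D0 * Num.sqrt T%:R by rewrite sqrtrM.
set l := 1 + ln _.
set s := Num.sqrt T%:R; have s0 : s != 0 by rewrite gt_eqF// sqrtr_gt0.
have -> : T%:R = s ^+ 2 by rewrite sqr_sqrtr.
by rewrite le_eqVlt; apply/predU1P; left; field.
Qed.
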